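(* Let $(\mathcal{A},\mathcal{R})$ be a complete filtered Rota--Baxter algebra of weight $\lambda=1$ over a field $K$ of characteristic zero, endowed with its associated post-Lie algebra structure, with Lie bracket $[x,y]=xy-yx$ and post-Lie product $x\rhd y=[\mathcal{R}(x),y]$. Then the post-Lie Magnus expansion $\chi$ of this post-Lie algebra coincides with the Baker--Campbell--Hausdorff recursion $\chi_{1}$ of weight $\lambda=1$, that is, $$\chi(x)=\chi_{1}(x)\qquad\text{for all }x\in\mathcal{A}_1 .$$
   Context: Throughout, $K$ is a field of characteristic zero. Rota--Baxter algebras. A Rota--Baxter algebra of weight $\lambda\in K$ is an associative $K$-algebra $\mathcal{A}$ with a $K$-linear map $\mathcal{R}:\mathcal{A}\to\mathcal{A}$ such that $\mathcal{R}(x)\mathcal{R}(y)=\mathcal{R}\big(\mathcal{R}(x)y+x\mathcal{R}(y)+\lambda xy\big)$ for all $x,y\in\mathcal{A}$. It is complete filtered if $\mathcal{A}$ is unital and equipped with a decreasing filtration $\mathcal{A}=\mathcal{A}_0\supseteq\mathcal{A}_1\supseteq\mathcal{A}_2\supseteq\cdots$ by two-sided ideals with $\mathcal{R}(\mathcal{A}_n)\subseteq\mathcal{A}_n$, $\mathcal{A}_m\mathcal{A}_n\subseteq\mathcal{A}_{m+n}$, $\bigcap_n\mathcal{A}_n=\{0\}$, and $\mathcal{A}$ complete for the topology defined by the filtration (so every series $\sum_n a_n$ with $a_n\in\mathcal{A}_n$ converges). BCH-recursion. The Baker--Campbell--Hausdorff series is $\mathrm{BCH}(x,y)=\log(\exp(x)\exp(y))=x+y+\widetilde{\mathrm{BCH}}(x,y)$,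 so $\widetilde{\mathrm{BCH}}(x,y)=\frac12[x,y]+\frac1{12}[x,[x,y]]-\frac1{12}[y,[x,y]]+\cdots$, a series of iterated commutators; it converges in $\mathcal{A}$ for $x,y\in\mathcal{A}_1$. For a complete filtered Rota--Baxter algebra of weight $\lambda\ne0$, put $\widetilde{\mathcal{R}}:=-\lambda\,\mathrm{id}_{\mathcal{A}}-\mathcal{R}$; the weighted BCH-recursion is the unique map $\chi_\lambda:\mathcal{A}_1\to\mathcal{A}_1$ with $$\chi_\lambda(x)=x+\frac1\lambda\widetilde{\mathrm{BCH}}\big(\mathcal{R}(\chi_\lambda(x)),\widetilde{\mathcal{R}}(\chi_\lambda(x))\big)\qquad(x\in\mathcal{A}_1).$$ Thus $\chi_1$ satisfies $\chi_1(x)=x+\widetilde{\mathrm{BCH}}\big(\mathcal{R}(\chi_1(x)),\widetilde{\mathcal{R}}(\chi_1(x))\big)$ with $\widetilde{\mathcal{R}}=-\mathrm{id}_{\mathcal{A}}-\mathcal{R}$. Post-Lie structure and Grossman--Larson product. A post-Lie algebra is a Lie algebra $(\mathcal{L},[\cdot,\cdot])$ with a bilinear product $\rhd$ such that $x\rhd[y,z]=[x\rhd y,z]+[y,x\rhd z]$ and $[x,y]\rhd z=a_\rhd(x,y,z)-a_\rhd(y,x,z)$, where $a_\rhd(x,y,z)=x\rhd(y\rhd z)-(x\rhd y)\rhd z$. A weight $1$ Rota--Baxter algebra is a post-Lie algebra with the commutator bracket and $x\rhd y:=[\mathcal{R}(x),y]$. Let $\mathcal{U}(\mathcal{L})$ be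 the universal enveloping algebra of $(\mathcal{L},[\cdot,\cdot])$, with product written by juxtaposition, unit $\mathbf{1}$, counit $\epsilon$, and unshuffle coproduct $\Delta(X)=X_{(1)}\otimes X_{(2)}$ (the algebra morphism for which elements of $\mathcal{L}$ are primitive). The product $\rhd$ extends uniquely to a bilinear product on $\mathcal{U}(\mathcal{L})$ with: $\mathbf{1}\rhd X=X$; $X\rhd\mathbf{1}=\epsilon(X)\mathbf{1}$; $xX\rhd y=x\rhd(X\rhd y)-(x\rhd X)\rhd y$; $X\rhd(YZ)=(X_{(1)}\rhd Y)(X_{(2)}\rhd Z)$, for $x,y\in\mathcal{L}$, $X,Y,Z\in\mathcal{U}(\mathcal{L})$. The Grossman--Larson product $X\ast Y:=X_{(1)}(X_{(2)}\rhd Y)$ is an associative product on $\mathcal{U}(\mathcal{L})$ with unit $\mathbf{1}$. Post-Lie Magnus expansion. It is defined by $\exp^{\ast}(\chi(x))=\exp(x)$, i.e. $\chi(x)=\log^{\ast}(\exp(x))$, where $\exp^{\ast}$ and $\log^{\ast}$ are the exponential and logarithm series for $\ast$, and $\exp$ is the exponential for the usual product of $\mathcal{U}(\mathcal{L})$. Precisely, with a commuting indeterminate $t$, $\chi(tx)=\sum_{n\ge1}\chi^{(n)}(x)t^n$ is the unique series without constant term in $\mathcal{U}(\mathcal{L})[[t]]$ with $\exp^{\ast}(\chi(tx))=\exp(tx)$; equivalently $\chi^{(1)}(x)=x$ and $$\chi^{(n)}(x)=\frac{x^n}{n!}-\sum_{k=2}^n\frac1{k!}\sum_{\substack{p_1+\cdots+p_k=n\\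 p_i>0}}\chi^{(p_1)}(x)\ast\cdots\ast\chi^{(p_k)}(x).$$ Each $\chi^{(n)}(x)$ lies in $\mathcal{L}$ and is a $K$-linear combination (with universal coefficients) of monomials of degree $n$ in $x$ formed with $[\cdot,\cdot]$ and $\rhd$. For $\mathcal{L}=\mathcal{A}$ a complete filtered Rota--Baxter algebra of weight $1$ and $x\in\mathcal{A}_1$, one has $\chi^{(n)}(x)\in\mathcal{A}_n$, and $\chi(x):=\sum_{n\ge1}\chi^{(n)}(x)\in\mathcal{A}_1$. *)

(* Defs.v *)
From HB Require Import structures.
From mathcomp Require Import all_boot all_order all_algebra.
From mathcomp Require Import boolp classical_sets.

Set Implicit Arguments.
Unset Strict Implicit.
Unset Printing Implicit Defensive.

Import GRing.Theory.
Local Open Scope ring_scope.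

Record postlie (K : fieldType) (L : lmodType K) := PostLie {
  lie : {bilinear L -> L -> L};
  tri : {bilinear L -> L -> L};
  lie_alt : forall x, lie x x = 0;
  lie_jacobi : forall x y z,
    lie x (lie y z) + lie y (lie z x) + lie z (lie x y) = 0;
  tri_derivation : forall x y z,
    tri x (lie y z) = lie (tri x y) z + lie y (tri x z);
  tri_associator : forall x y z,
    let a u v w := tri u (tri v w) - tri (tri u v) w in
    tri (lie x y) z = a x y z - a y x z
}.

Definition lie_to_alg (K : fieldType) (L : lmodType K) (P : postlie L)
    (B : algType K) (f : L -> B) : Prop :=
  forall x y, f (lie P x y) = f x * f y - f y * f x.

(* The enveloping algebra, and its tensor square, are given by their universal
   properties; an algType is nonzero, which is harmless here since maps into
   the zero algebra exist and are unique. *)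
Record envelope (K : fieldType) (L : lmodType K) (P : postlie L) := Envelope {
  env : algType K;
  env_in : {linear L -> env};
  env_in_lie : lie_to_alg P env_in;
  env_universal : forall (B : algType K) (f : {linear L -> B}),
    lie_to_alg P f ->
    exists g : {lrmorphism env -> B},
      (forall x, g (env_in x) = f x) /\
      (forall g' : {lrmorphism env -> B},
         (forall x, g' (env_in x) = f x) -> g' =1 g);
  env2 : algType K;
  tens : {bilinear env -> env -> env2};
  tens1 : tens 1 1 = 1;
  tensM : forall X Y Z T, tens X Y * tens Z T = tens (X * Z) (Y * T);
  tens_universal : forall (V : lmodType K) (f : {bilinear env -> env -> V}),
    exists g : {linear env2 -> V},
      (forall X Y, g (tens X Y) = f X Y) /\
      (forall g' : {linear env2 -> V},
         (forall X Y, g' (tens X Y) = f X Y) -> g' =1 g);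
  coprod : {lrmorphism env -> env2};
  coprod_in : forall x,
    coprod (env_in x) = tens (env_in x) 1 + tens 1 (env_in x);
  counit : {lrmorphism env -> K^o};
  counit_in : forall x, counit (env_in x) = 0
}.

(* A finite list of pairs (X_(1), X_(2)) with Delta(X) = sum X_(1) (x) X_(2);
   it is only used under expressions bilinear in (X_(1), X_(2)), whose sum does
   not depend on the chosen list. *)
Definition sweedler (K : fieldType) (L : lmodType K) (P : postlie L)
    (E : envelope P) (X : env E) : seq (env E * env E) :=
  xget [::] [set s : seq (env E * env E) |
    coprod E X = \sum_(p <- s) tens E p.1 p.2].

Record postlie_envelope (K : fieldType) (L : lmodType K) (P : postlie L) :=
  PostLieEnvelope {
  plenv :> envelope P;
  etri : {bilinear env plenv -> env plenv -> env plenv};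
  etri_in : forall x y : L,
    etri (env_in plenv x) (env_in plenv y) = env_in plenv (tri P x y);
  etri1l : forall X, etri 1 X = X;
  etri1r : forall X, etri X 1 = counit plenv X *: 1;
  etriMl : forall (x y : L) (X : env plenv),
    let x' := env_in plenv x in let y' := env_in plenv y in
    etri (x' * X) y' = etri x' (etri X y') - etri (etri x' X) y';
  etriMr : forall X Y Z,
    etri X (Y * Z) = \sum_(p <- sweedler X) etri p.1 Y * etri p.2 Z
}.

Definition grossman_larson (K : fieldType) (L : lmodType K) (P : postlie L)
    (E : postlie_envelope P) (X Y : env E) : env E :=
  \sum_(p <- sweedler X) p.1 * etri E p.2 Y.

Arguments grossman_larson {K L P} E X Y.

(* A formal power series in t with coefficients in U is its coefficient
   sequence nat -> U; the product m on U is a parameter. *)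
Section PowerSeries.
Variables (K : fieldType) (U : lmodType K) (m : U -> U -> U) (e : U).

Definition fps_mul (a b : nat -> U) : nat -> U :=
  fun n => \sum_(i < n.+1) m (a i) (b (n - i)%N).

Definition fps_pow (a : nat -> U) (k : nat) : nat -> U :=
  iter k (fps_mul a) (fun n => if n == 0%N then e else 0).

(* For a series with zero constant term: a^k has no term of degree < k, so the
   coefficient of t^n in sum_k a^k / k! only involves k <= n. *)
Definition fps_exp (a : nat -> U) : nat -> U :=
  fun n => \sum_(k < n.+1) (k`!%:R : K)^-1 *: fps_pow a k n.
End PowerSeries.

(* c is the coefficient sequence of chi(tx): exp^*(chi(tx)) = exp(tx). *)
Definition magnus_series (K : fieldType) (L : lmodType K) (P : postlie L)
    (E : postlie_envelope P) (x : L) (c : nat -> env E) : Prop :=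
  c 0%N = 0 /\
  fps_exp (grossman_larson E) 1 c =1
  fps_exp *%R 1 (fun n => if n == 1%N then env_in E x else 0).

Arguments magnus_series {K L P} E x c.

Definition rota_baxter (K : fieldType) (A : algType K) (lam : K)
    (R : {linear A -> A}) : Prop :=
  forall x y, R x * R y = R (R x * y + x * R y + lam *: (x * y)).

Definition fcvg (K : fieldType) (A : algType K) (F : nat -> set A)
    (u : nat -> A) (l : A) : Prop :=
  forall N, exists M, forall n, (M <= n)%N -> F N (u n - l).

Definition fcauchy (K : fieldType) (A : algType K) (F : nat -> set A)
    (u : nat -> A) : Prop :=
  forall N, exists M, forall p q, (M <= p)%N -> (M <= q)%N -> F N (u p - u q).

Record complete_filtration (K : fieldType) (A : algType K)
    (R : {linear A -> A}) (F : nat -> set A) : Prop := CompleteFiltration {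
  filt0 : F 0%N = setT;
  filtS : forall n, (F n.+1 `<=` F n)%classic;
  filt_zero : forall n, F n 0;
  filt_linear : forall n (k : K) x y, F n x -> F n y -> F n (k *: x + y);
  filt_ideal : forall n a x, F n x -> F n (a * x) /\ F n (x * a);
  filt_rb : forall n x, F n x -> F n (R x);
  filtM : forall m n x y, F m x -> F n y -> F (m + n)%N (x * y);
  filt_separated : forall x, (forall n, F n x) -> x = 0;
  filt_complete : forall u, fcauchy F u -> exists l, fcvg F u l
}.

Section BCH.
Variables (K : fieldType) (A : algType K) (F : nat -> set A).

Definition flim (u : nat -> A) : A := xget 0 [set l | fcvg F u l].

Definition fexp (x : A) : A :=
  flim (fun N => \sum_(n < N) (n`!%:R : K)^-1 *: x ^+ n).

Definition flog (y : A) : A :=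
  flim (fun N => \sum_(n < N) ((-1) ^+ n / n.+1%:R : K) *: (y - 1) ^+ n.+1).

(* For x, y in F 1 all these limits exist, and this is the sum in A of the
   formal series log(exp(x) exp(y)). *)
Definition BCH (x y : A) : A := flog (fexp x * fexp y).

Definition BCHtilde (x y : A) : A := BCH x y - x - y.

Definition bch_recursion (lam : K) (R : {linear A -> A}) (chi : A -> A) :
    Prop :=
  let Rt z := - (lam *: z) - R z in
  forall x, F 1%N x ->
    F 1%N (chi x) /\
    chi x = x + lam^-1 *: BCHtilde (R (chi x)) (Rt (chi x)).
End BCH.

Section RotaBaxterPostLie.
Variables (K : fieldType) (A : algType K).

Definition commutator (x y : A) : A := x * y - y * x.

Lemma commutator_bilinear : bilinear_for *:%R *:%R commutator.
Proof.
by split=> z k x y; rewrite /commutator /= mulrDl mulrDr -scalerAl -scalerAr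
  opprD addrACA scalerBr.
Qed.
HB.instance Definition _ := bilinear_isBilinear.Build K A A A *:%R *:%R
  commutator commutator_bilinear.

Lemma commutatorDl x y z :
  commutator (x + y) z = commutator x z + commutator y z.
Proof. exact: linearDl. Qed.

Lemma commutatorNl x y : commutator (- x) y = - commutator x y.
Proof. exact: linearNl. Qed.

Lemma commutator_alt x : commutator x x = 0.
Proof. exact: subrr. Qed.

Lemma commutatorC x y : commutator x y = - commutator y x.
Proof. by rewrite /commutator opprB. Qed.

Lemma commutatorM x y z :
  commutator x (y * z) = commutator x y * z + y * commutator x z.
Proof. by rewrite /commutator mulrBl mulrBr !mulrA subrKA. Qed.

Lemma commutator_derivation x y z :
  commutator x (commutator y z) =
  commutator (commutator x y) z + commutator y (commutator x z).
Proof.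
have cE u v : commutator u v = u * v - v * u by [].
rewrite [commutator y z]cE linearBr /= !commutatorM.
rewrite [commutator (commutator x y) z]cE [commutator y (commutator _ _)]cE.
by rewrite opprD [- _ + - _]addrC addrACA.
Qed.

Lemma commutator_jacobi x y z :
  commutator x (commutator y z) + commutator y (commutator z x) +
  commutator z (commutator x y) = 0.
Proof.
rewrite commutator_derivation [commutator z x]commutatorC linearNr /= addrK.
by rewrite [commutator z _]commutatorC subrr.
Qed.

Variable R : {linear A -> A}.

Definition rb_triangle (x y : A) : A := commutator (R x) y.

Lemma rb_triangle_bilinear : bilinear_for *:%R *:%R rb_triangle.
Proof.
split=> z k x y; rewrite /rb_triangle /=.
  by rewrite linearP linearPl.
by rewrite linearPr.
Qed.
HB.instance Definition _ := bilinear_isBilinear.Build K A A A *:%R *:%R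
  rb_triangle rb_triangle_bilinear.

Hypothesis rbR : rota_baxter 1 R.

Lemma rb_commutator x y : commutator (R x) (R y) =
  R (commutator (R x) y + commutator x (R y) + commutator x y).
Proof.
rewrite {1}/commutator !rbR !scale1r -linearB; congr (R _).
rewrite [R y * x + _]addrC opprD addrACA; congr (_ + _).
by rewrite opprD addrACA.
Qed.

Lemma rb_triangle_associator x y z :
  let a u v w := rb_triangle u (rb_triangle v w)
                 - rb_triangle (rb_triangle u v) w in
  rb_triangle (commutator x y) z = a x y z - a y x z.
Proof.
rewrite /= /rb_triangle.
have -> : commutator (R x) (commutator (R y) z) =
    commutator (R (commutator (R x) y + commutator x (R y) + commutator x y)) z
    + commutator (R y) (commutator (R x) z).
  by rewrite commutator_derivation rb_commutator.
have RE u v w : R (u - v + w) = R u - R v + R w by rewrite raddfD raddfB.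
rewrite [commutator x (R y)]commutatorC RE !commutatorDl commutatorNl.
set a := commutator (R (commutator (R x) y)) z.
set b := commutator (R (commutator (R y) x)) z.
set c := commutator (R (commutator x y)) z.
set d := commutator (R y) (commutator (R x) z).
clearbody a b c d.
have -> : a - b + c + d - a = c + (d - b).
  by rewrite -!addrA addrC !addrA subrK -addrA addrC.
by rewrite addrK.
Qed.

Definition rb_postlie : postlie A := {|
  lie := commutator;
  tri := rb_triangle;
  lie_alt := commutator_alt;
  lie_jacobi := commutator_jacobi;
  tri_derivation := fun x y z => commutator_derivation (R x) y z;
  tri_associator := rb_triangle_associator
|}.
End RotaBaxterPostLie.

Section MagnusExpansion.
Variables (K : fieldType) (A : algType K) (R : {linear A -> A}).
Variables (rbR : rota_baxter 1 R) (F : nat -> set A).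

(* y is the value of the post-Lie Magnus expansion at x: the coefficients of
   chi(tx) lie in A and their sum converges to y. *)
Definition magnus_expansion (E : postlie_envelope (rb_postlie rbR)) (x y : A) :
    Prop :=
  exists2 c : nat -> A,
    magnus_series E x (fun n => env_in E (c n)) &
    fcvg F (fun N => \sum_(n < N) c n) y.
End MagnusExpansion.

(* Main.v *)
From HB Require Import structures.
Require Import Defs.
From mathcomp Require Import all_boot all_order all_algebra.
From mathcomp Require Import boolp classical_sets functions.

Set Implicit Arguments.
Unset Strict Implicit.
Unset Printing Implicit Defensive.

Import GRing.Theory.
Local Open Scope ring_scope.

(** Let U be the enveloping algebra of A and iota the inclusion of A in U. The
    product x |> y = [R x, y] extends to U so that x |> - is a derivation for x
    in A; hence x |> Y = [iota (R x), Y] for every Y in U, and the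
    Grossman--Larson product satisfies
      x * Y = iota (x + R x) Y - Y iota (R x)
    (rb_grossman_larson). Left and right multiplications commute, so the star
    exponential factors as exp^*(c) = exp(iota (c + R c)) exp(- iota (R c))
    (star_exp_factorization). The series c is therefore the Magnus expansion
    of tx exactly when
      exp(c + R c) exp(- R c) = exp(tx).
    On the other side, after taking exponentials and inverses, the
    BCH-recursion at x says exp(z + R z) exp(- R z) = exp(x) for z = chi_1(x)
    (bch_recursion_atkinson). The map z |-> exp(z + R z) exp(- R z) is tangent
    to the identity, so in a complete filtered algebra it is injective, with all
    values congruent to 1 attained (atkinson_inj, atkinson_surj). Both sides of
    the theorem thus solve the same uniquely solvable equation.

    Three points remain. First, the equation for c lives over U, but is wanted
    over A. The identity of A induces an algebra morphism from U
    to A, which carries it over. Conversely iota preserves only commutators, but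
    the logarithmic derivative of a product of exponentials is made of
    commutators, and f' = x f with f(0) = 1 characterizes exp(tx)
    (magnus_seriesP). This also shows that the coefficients of the Magnus series
    lie in A, as solving the equation over A already provides them. Second, one
    sets t = 1: the coefficients of the solution satisfy c_n in F n
    (graded_of_atkinson), and summing such series is multiplicative and commutes
    with exp (fsumM, fsum_fexp). Third, exp(log w) = w in A, which is needed
    because the recursion is written with BCH; this is the value at t = 1 of
    exp(log(1 + wt)) = 1 + wt, again proved by a differential equation
    (flogK). *)

(** * Formal power series as an algebra *)

(** A separate name for nat -> U, because functions into a ring already carry
    the pointwise product. *)
Definition fps (U : Type) : Type := nat -> U.

HB.instance Definition _ (U : eqType) := gen_eqMixin (fps U).
HB.instance Definition _ (U : choiceType) := gen_choiceMixin (fps U).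

Section FpsAlgebra.
Variables (K : fieldType) (U : algType K).

HB.instance Definition _ := GRing.Lmodule.copy (fps U) (nat -> U).

Implicit Types a b c : fps U.

Lemma fpsDE a b n : (a + b) n = a n + b n. Proof. by []. Qed.
Lemma fpsNE a n : (- a) n = - a n. Proof. by []. Qed.
Lemma fpsBE a b n : (a - b) n = a n - b n. Proof. by []. Qed.
Lemma fpsZE (k : K) a n : (k *: a) n = k *: a n. Proof. by []. Qed.

Lemma fps_sumE I (r : seq I) (P : pred I) (f : I -> fps U) n :
  (\sum_(i <- r | P i) f i) n = \sum_(i <- r | P i) f i n.
Proof.
by apply: (big_morph (fun a : fps U => a n) (id1 := 0) (op1 := +%R)) => // u v.
Qed.

Definition fps_one : fps U := fun n => if n == 0%N then 1 else 0.

(** Each coefficient of a product of series is a coefficient of a product of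
    truncations, so associativity comes from that of polynomials. *)
Definition fps_trunc N a : {poly U} := \poly_(i < N) a i.

Lemma fps_mul_trunc N a b n : (n < N)%N ->
  fps_mul *%R a b n = (fps_trunc N a * fps_trunc N b)`_n.
Proof.
move=> ltnN; rewrite coefM; apply: eq_bigr => i _.
have lein : (i <= n)%N by rewrite -ltnS.
by rewrite !coef_poly (leq_ltn_trans lein) // (leq_ltn_trans (leq_subr _ _)).
Qed.

Lemma fps_mul_truncl N (p : {poly U}) b n : (n < N)%N ->
  \sum_(i < n.+1) p`_i * b (n - i)%N = (p * fps_trunc N b)`_n.
Proof.
move=> ltnN; rewrite coefM; apply: eq_bigr => i _.
by rewrite coef_poly (leq_ltn_trans (leq_subr _ _) ltnN).
Qed.

Lemma fps_mul_truncr N a (p : {poly U}) n : (n < N)%N ->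
  \sum_(i < n.+1) a i * p`_(n - i)%N = (fps_trunc N a * p)`_n.
Proof.
move=> ltnN; rewrite coefM; apply: eq_bigr => i _.
have lein : (i <= n)%N by rewrite -ltnS.
by rewrite coef_poly (leq_ltn_trans lein).
Qed.

Lemma fps_mulA : associative (@fps_mul K U *%R).
Proof.
move=> a b c; apply/funext => n.
transitivity ((fps_trunc n.+1 a * (fps_trunc n.+1 b * fps_trunc n.+1 c))`_n).
  rewrite -fps_mul_truncr //; apply: eq_bigr => i _.
  by rewrite (@fps_mul_trunc n.+1) // ltnS leq_subr.
rewrite mulrA -fps_mul_truncl //; apply: eq_bigr => i _.
by rewrite (@fps_mul_trunc n.+1).
Qed.

Lemma fps_mul1 : left_id fps_one (@fps_mul K U *%R).
Proof.
move=> a; apply/funext => n; rewrite /fps_mul big_ord_recl /= mul1r subn0.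
by rewrite big1 ?addr0 // => i _; rewrite mul0r.
Qed.

Lemma fps_mulr1 : right_id fps_one (@fps_mul K U *%R).
Proof.
move=> a; apply/funext => n; rewrite /fps_mul big_ord_recr /= subnn mulr1.
by rewrite big1 ?add0r // => i _; rewrite /fps_one subn_eq0 leqNgt ltn_ord mulr0.
Qed.

Lemma fps_mulDl : left_distributive (@fps_mul K U *%R) +%R.
Proof.
move=> a b c; apply/funext => n; rewrite fpsDE /fps_mul -big_split /=.
by apply: eq_bigr => i _; rewrite mulrDl.
Qed.

Lemma fps_mulDr : right_distributive (@fps_mul K U *%R) +%R.
Proof.
move=> a b c; apply/funext => n; rewrite fpsDE /fps_mul -big_split /=.
by apply: eq_bigr => i _; rewrite mulrDr.
Qed.

Lemma fps_one_neq0 : fps_one != 0.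
Proof.
by apply/eqP => /(congr1 (fun a : fps U => a 0%N)) /eqP; rewrite oner_eq0.
Qed.

HB.instance Definition _ := GRing.Zmodule_isNzRing.Build (fps U)
  fps_mulA fps_mul1 fps_mulr1 fps_mulDl fps_mulDr fps_one_neq0.

Lemma fpsME a b n : (a * b) n = \sum_(i < n.+1) a i * b (n - i)%N.
Proof. by []. Qed.

Lemma fps_scaleAl (k : K) a b : k *: (a * b) = (k *: a) * b.
Proof.
apply/funext => n; rewrite fpsZE !fpsME scaler_sumr.
by apply: eq_bigr => i _; rewrite scalerAl.
Qed.

HB.instance Definition _ := GRing.Lmodule_isLalgebra.Build K (fps U) fps_scaleAl.

Lemma fps_scaleAr (k : K) a b : k *: (a * b) = a * (k *: b).
Proof.
apply/funext => n; rewrite fpsZE !fpsME scaler_sumr.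
by apply: eq_bigr => i _; rewrite fpsZE scalerAr.
Qed.

HB.instance Definition _ := GRing.Lalgebra_isAlgebra.Build K (fps U) fps_scaleAr.

Lemma fps_powE a k : @fps_pow K U *%R 1 a k = a ^+ k.
Proof. by elim: k => [|k IH]; rewrite ?exprS -?IH. Qed.

End FpsAlgebra.

(** * Summation in complete filtered algebras *)

(** A summability condition stable under Cauchy products. For a power series it
    says that the series can be evaluated at t = 1. *)
Definition graded (K : fieldType) (A : algType K) (F : nat -> set A)
  (p : nat -> A) : Prop := forall n, F n (p n).

Definition fsum (K : fieldType) (A : algType K) (F : nat -> set A)
  (p : nat -> A) : A := flim F (fun N => \sum_(n < N) p n).

Section FilteredAlgebra.
Variables (K : fieldType) (A : algType K) (R : {linear A -> A}).
Variables (F : nat -> set A) (filtF : complete_filtration R F).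
Implicit Types (x y z a b v : A) (p q : nat -> A) (n N : nat).

Let F0 n : F n 0 := filt_zero filtF n.

Lemma filtD n x y : F n x -> F n y -> F n (x + y).
Proof. by move=> Fx Fy; rewrite -[x]scale1r; apply: (filt_linear filtF). Qed.

Lemma filtZ n (k : K) x : F n x -> F n (k *: x).
Proof. by move=> Fx; rewrite -[_ *: _]addr0; apply: (filt_linear filtF). Qed.

Lemma filtN n x : F n x -> F n (- x).
Proof. by rewrite -scaleN1r; apply: filtZ. Qed.

Lemma filtB n x y : F n x -> F n y -> F n (x - y).
Proof. by move=> Fx /filtN; apply: filtD. Qed.

Lemma filt_sum n I (r : seq I) (P : pred I) (f : I -> A) :
  (forall i, P i -> F n (f i)) -> F n (\sum_(i <- r | P i) f i).
Proof. by move=> Ff; elim/big_ind: _ => // x y; apply: filtD. Qed.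

Lemma filt_le m n x : (m <= n)%N -> F n x -> F m x.
Proof.
move=> /subnK <-; elim: (n - m)%N => // k IH /(filtS filtF); exact: IH.
Qed.

Lemma filtMl n a x : F n x -> F n (a * x).
Proof. by move=> /(filt_ideal filtF a)[]. Qed.

Lemma filtMr n a x : F n x -> F n (x * a).
Proof. by move=> /(filt_ideal filtF a)[]. Qed.

Lemma filtC n x y : F n (x - y) -> F n (y - x).
Proof. by move=> /filtN; rewrite opprB. Qed.

Lemma filt_trans n y x z : F n (x - y) -> F n (y - z) -> F n (x - z).
Proof. by move=> Fxy /(filtD Fxy); rewrite subrKA. Qed.

Lemma filt_eqD n x x' y y' :
  F n (x - x') -> F n (y - y') -> F n (x + y - (x' + y')).
Proof. by move=> Fx Fy; rewrite opprD addrACA; apply: filtD. Qed.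

Lemma filt_eqB n x x' y y' :
  F n (x - x') -> F n (y - y') -> F n (x - y - (x' - y')).
Proof. by move=> Fx Fy; apply: filt_eqD => //; rewrite -opprD; apply: filtN. Qed.

Lemma filt_eqM n x x' y y' :
  F n (x - x') -> F n (y - y') -> F n (x * y - x' * y').
Proof.
move=> Fx Fy; apply: (@filt_trans _ (x * y')).
  by rewrite -mulrBr; apply: filtMl.
by rewrite -mulrBl; apply: filtMr.
Qed.

Lemma filt_eqX n x x' k : F n (x - x') -> F n (x ^+ k - x' ^+ k).
Proof.
move=> Fx; elim: k => [|k IH]; first by rewrite subrr.
by rewrite !exprS; apply: filt_eqM.
Qed.

Lemma filtX x n : F 1%N x -> F n (x ^+ n).
Proof.
move=> Fx; elim: n => [|n IH]; first by rewrite (filt0 filtF).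
by rewrite exprS -add1n; apply: (filtM filtF).
Qed.

Lemma filt_eq x y : (forall n, F n (x - y)) -> x = y.
Proof. by move=> /(filt_separated filtF)/eqP; rewrite subr_eq0 => /eqP. Qed.

Lemma fsum_cvg p : graded F p -> fcvg F (fun N => \sum_(n < N) p n) (fsum F p).
Proof.
move=> Fp; rewrite /fsum /flim.
have [l ul] : exists l, fcvg F (fun N => \sum_(n < N) p n) l.
  apply: (filt_complete filtF) => N; exists N.
  suff tail M : (N <= M)%N -> F N (\sum_(n < M) p n - \sum_(n < N) p n).
    by move=> M M' /tail FM /tail /filtC; apply: filt_trans.
  move=> leNM; rewrite -!(big_mkord xpredT) (big_cat_nat (leq0n N) leNM) //=.
  rewrite addrAC subrr add0r.
  rewrite big_nat; apply: filt_sum => n /andP[leNn _].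
  exact: filt_le (Fp n).
exact: (xgetPex (P := [set l | _]) 0 (ex_intro _ l ul)).
Qed.

(** The basic estimate: modulo F N a sum of graded terms is its N-th partial
    sum. Every identity between limits below is reduced by it to finite sums
    modulo F N, for all N. *)
Lemma fsum_mod p N : graded F p -> F N (fsum F p - \sum_(n < N) p n).
Proof.
move=> Fp; have [M cvgM] := fsum_cvg Fp N.
pose M' := maxn M N; apply: (@filt_trans _ (\sum_(n < M') p n)).
  by apply/filtC/cvgM; rewrite leq_maxl.
have leNM : (N <= M')%N by rewrite leq_maxr.
rewrite -!(big_mkord xpredT) (big_cat_nat (leq0n N) leNM) //=.
rewrite addrAC subrr add0r.
rewrite big_nat; apply: filt_sum => n /andP[leNn _].
exact: filt_le (Fp n).
Qed.

Lemma fcvg_unique (u : nat -> A) l l' : fcvg F u l -> fcvg F u l' -> l = l'.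
Proof.
move=> ul ul'; apply: filt_eq => N.
have [M uM] := ul N; have [M' uM'] := ul' N.
have leM := leq_maxl M M'; have leM' := leq_maxr M M'.
by apply: (filt_trans (filtC (uM _ leM))); apply: uM'.
Qed.

Lemma fsum_unique p l : graded F p ->
  (forall N, F N (l - \sum_(n < N) p n)) -> l = fsum F p.
Proof.
move=> Fp lp; apply: filt_eq => N.
by apply: (filt_trans (lp N)); apply/filtC/fsum_mod.
Qed.

Lemma fsum_filt n p : graded F p -> (forall i, F n (p i)) -> F n (fsum F p).
Proof.
move=> Fp Fnp; rewrite -[fsum F p](subrK (\sum_(i < n) p i)).
by apply: filtD; [apply: fsum_mod | apply: filt_sum].
Qed.

Lemma sum_triangle N (f : nat -> nat -> A) :
  \sum_(n < N) \sum_(i < n.+1) f i (n - i)%N =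
  \sum_(i < N) \sum_(j < N - i) f i j.
Proof.
elim: N => [|N IH]; first by rewrite !big_ord0.
rewrite big_ord_recr /= IH [RHS]big_ord_recr /= subSnn big_ord1.
rewrite [X in _ + X]big_ord_recr /= subnn addrA; congr (_ + _).
rewrite -big_split /=; apply: eq_bigr => i _.
by rewrite subSn ?big_ord_recr // ltnW.
Qed.

Lemma gradedM p q : graded F p -> graded F q -> graded F (fps_mul *%R p q).
Proof.
move=> Fp Fq n; apply: filt_sum => i _.
by rewrite -{1}(@subnKC i n) -1?ltnS //; apply: (filtM filtF).
Qed.

(** Cauchy product. As a sequence in A is also a power series over A, this says
    that evaluation at t = 1 is multiplicative on graded series. Modulo F N,
    the terms p_i q_j with i + j >= N that separate the product of the partial
    sums from the partial sum of the product vanish. *)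
Lemma fsumM p q : graded F p -> graded F q ->
  fsum F p * fsum F q = fsum F (fps_mul *%R p q).
Proof.
move=> Fp Fq; apply: fsum_unique => [|N]; first exact: gradedM.
apply: (@filt_trans _ ((\sum_(n < N) p n) * fsum F q)).
  by rewrite -mulrBl; apply/filtMr/fsum_mod.
rewrite (sum_triangle N (fun i j => p i * q j)) mulr_suml -sumrB.
apply: filt_sum => i _; rewrite -mulr_sumr -mulrBr.
rewrite -{1}(@subnKC i N) 1?ltnW //; apply: (filtM filtF) => //.
exact: fsum_mod.
Qed.

Lemma fsumD p q : graded F p -> graded F q ->
  fsum F (fun n => p n + q n) = fsum F p + fsum F q.
Proof.
move=> Fp Fq; apply/esym/fsum_unique => [n|N]; first exact: filtD.
by rewrite big_split /= opprD addrACA; apply: filtD; apply: fsum_mod.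
Qed.

End FilteredAlgebra.

(** Filtered additive maps are continuous. *)
Lemma fsum_map (K : fieldType) (A B : algType K) (R : {linear A -> A})
    (S : {linear B -> B}) (F : nat -> set A) (G : nat -> set B)
    (filtF : complete_filtration R F) (filtG : complete_filtration S G)
    (h : {additive A -> B}) (p : nat -> A) :
  (forall n x, F n x -> G n (h x)) -> graded F p ->
  h (fsum F p) = fsum G (h \o p).
Proof.
move=> Fh Fp; apply: (fsum_unique filtG) => [n|N] /=; first exact/Fh/Fp.
by rewrite -raddf_sum -raddfB; apply/Fh/(fsum_mod filtF).
Qed.

(** * Exponentials, commutators and derivations *)

Section CommutatorLinear.
Variables (K : fieldType) (A : algType K) (a : A).

Lemma commutator_linear : linear (commutator a).
Proof. by move=> k x y; exact: linearPr. Qed.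
HB.instance Definition _ :=
  GRing.isLinear.Build K A A *:%R (commutator a) commutator_linear.
End CommutatorLinear.

Section Binomial.
Variables (V : zmodType).

Lemma sum_pascal (f : nat -> V) k :
  \sum_(i < k.+2) f i *+ 'C(k.+1, i) =
  \sum_(i < k.+1) f i *+ 'C(k, i) + \sum_(i < k.+1) f i.+1 *+ 'C(k, i).
Proof.
rewrite big_ord_recl bin0.
under eq_bigr do rewrite binS mulrnDr.
rewrite big_split addrA /=; congr (_ + _).
by rewrite big_ord_recr /= bin_small // mulr0n addr0 [RHS]big_ord_recl bin0.
Qed.

(** Used twice: for left multiplication by a, which is ad a plus right
    multiplication by a, and for the sum of a left and a right multiplication. *)
Lemma iter_binomial (P Q : {additive V -> V}) k v :
  (forall u, P (Q u) = Q (P u)) ->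
  iter k (fun u => P u + Q u) v =
  \sum_(i < k.+1) iter i P (iter (k - i) Q v) *+ 'C(k, i).
Proof.
move=> PQ; have iPQ j u : Q (iter j P u) = iter j P (Q u).
  by elim: j => //= j <-; rewrite PQ.
elim: k => [|k IH]; first by rewrite big_ord1.
rewrite (sum_pascal (fun i => iter i P (iter (k.+1 - i) Q v))) addrC.
rewrite iterS IH !raddf_sum; congr (_ + _); apply: eq_bigr => i _.
  by rewrite raddfMn subSS.
rewrite raddfMn subSn -1?ltnS // iterS; congr (_ *+ _).
by rewrite iPQ.
Qed.

End Binomial.

Section Derivation.
Variables (K : fieldType) (A : algType K) (D : {additive A -> A}).
Hypothesis derM : forall x y, D (x * y) = D x * y + x * D y.

Lemma der1 : D 1 = 0.
Proof. by have := derM 1 1; rewrite !mulr1 mul1r -{1}[D 1]addr0 => /addrI. Qed.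

(** Moving every a to the right of D a in a sum of words a^i (D a) a^j creates
    the iterated commutators; Pascal's rule collects them. *)
Lemma derX a k : D (a ^+ k.+1) =
  \sum_(m < k.+1) iter m (commutator a) (D a) * a ^+ (k - m) *+ 'C(k.+1, m.+1).
Proof.
elim: k => [|k IH]; first by rewrite big_ord1 expr1 /= mulr1.
pose f m := iter m (commutator a) (D a) * a ^+ (k.+1 - m).
rewrite exprS derM IH mulr_sumr.
transitivity (\sum_(m < k.+2) f m *+ 'C(k.+1, m.+1) +
              \sum_(m < k.+2) f m *+ 'C(k.+1, m)); last first.
  by rewrite -big_split /=; apply: eq_bigr => i _; rewrite -mulrnDr -binS.
rewrite [X in _ = X + _]big_ord_recr /= bin_small // mulr0n addr0.
rewrite [X in _ = _ + X]big_ord_recl bin0 addrCA -big_split.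
congr (_ + _); apply: eq_bigr => m _ /=.
rewrite /f subSS subSn -1?ltnS // -mulrnDl; rewrite mulrnAr; congr (_ *+ _).
rewrite exprS iterS [commutator a _]/(_ - _).
by rewrite mulrBl !mulrA addrCA subrr addr0.
Qed.

End Derivation.

Section Exponential.
Variables (K : fieldType) (A : algType K) (R : {linear A -> A}).
Hypothesis charK : [pchar K] =i pred0.
Variables (F : nat -> set A) (filtF : complete_filtration R F).
Implicit Types (x y z a b v : A) (p q : nat -> A) (n N : nat).

Lemma natS_neq0 n : n.+1%:R != 0 :> K.
Proof. by move/pcharf0P: charK => ->. Qed.

Lemma inv_fact_bin n m : (m <= n)%N ->
  (n`!%:R)^-1 * 'C(n, m)%:R = (m`!%:R)^-1 * ((n - m)`!%:R)^-1 :> K.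
Proof.
move=> lemn; rewrite -(bin_fact lemn) !natrM !invfM.
have Cn0 : 'C(n, m)%:R != 0 :> K.
  by move/pcharf0P: charK => ->; rewrite -lt0n bin_gt0.
by rewrite mulrAC mulVf // mul1r mulrC.
Qed.

Definition divpow a n : A := (n`!%:R : K)^-1 *: a ^+ n.

Lemma divpow_graded a : F 1%N a -> graded F (divpow a).
Proof. by move=> Fa n; apply: (filtZ filtF); apply: (filtX filtF). Qed.

Lemma fexp_mod a N : F 1%N a -> F N (fexp F a - \sum_(n < N) divpow a n).
Proof. by move=> Fa; apply: (fsum_mod filtF); apply: divpow_graded. Qed.

Lemma fexp_filt1 a : F 1%N a -> F 1%N (fexp F a - 1).
Proof.
move=> /(fexp_mod 1); rewrite big_ord1 /divpow fact0.
by rewrite invr1 expr0 scale1r.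
Qed.

Lemma fsumMr p v : graded F p -> fsum F p * v = fsum F (fun n => p n * v).
Proof.
move=> Fp; apply: (fsum_unique filtF) => [n|N]; first exact: (filtMr filtF).
by rewrite -mulr_suml -mulrBl; apply/(filtMr filtF)/(fsum_mod filtF).
Qed.

Lemma fsum_head p : graded F p -> (forall n, p n.+1 = 0) -> fsum F p = p 0%N.
Proof.
move=> Fp p0; apply/esym/(fsum_unique filtF) => // -[|N].
  by rewrite (filt0 filtF).
rewrite big_ord_recl big1 => [|i _]; last exact: p0.
by rewrite addr0 subrr; apply: (filt_zero filtF).
Qed.

Lemma filt_ad a v n m : F 1%N a -> F n v -> F (m + n)%N (iter m (commutator a) v).
Proof.
move=> Fa Fv; elim: m => //= m IH; apply: (filtB filtF).
  by rewrite addSn -add1n; apply: (filtM filtF).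
by rewrite addSn -addn1; apply: (filtM filtF).
Qed.

Lemma ad_graded a v (k : nat -> K) : F 1%N a ->
  graded F (fun m => k m *: iter m (commutator a) v).
Proof.
move=> Fa m; apply: (filtZ filtF); rewrite -[m in F m]addn0.
by apply: filt_ad => //; rewrite (filt0 filtF).
Qed.

(** exp(ad a)(v). *)
Definition expad a v : A :=
  fsum F (fun m => (m`!%:R : K)^-1 *: iter m (commutator a) v).

(** exp(a) v exp(-a) = exp(ad a)(v), stated without the inverse. Since a v is
    (ad a) v + v a and the two summands commute as operators on v, the binomial
    formula rewrites a^n v / n! as a term of a Cauchy product. *)
Lemma fexp_conj a v : F 1%N a -> fexp F a * v = expad a v * fexp F a.
Proof.
move=> Fa; have Fe := divpow_graded Fa.
have Fad := ad_graded v (fun m => (m`!%:R)^-1) Fa.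
rewrite /expad [fexp F a]/(fsum F (divpow a)) (fsumM filtF) // fsumMr //.
congr (fsum F _); apply/funext => n.
have aE : iter n (fun u => commutator a u + (a \o* idfun) u) v = a ^+ n * v.
  elim: n => [|n IH]; first by rewrite mul1r.
  by rewrite iterS IH /= [commutator _ _]/(_ - _) subrK exprS mulrA.
have aC u : commutator a ((a \o* idfun) u) = (a \o* idfun) (commutator a u).
  by rewrite /commutator /= mulrBl mulrA.
have rE j u : iter j (a \o* idfun) u = u * a ^+ j.
  by elim: j => [|j /= ->]; rewrite ?mulr1 // exprSr mulrA.
rewrite -scalerAl -aE (@iter_binomial _ (commutator a) (a \o* idfun) _ _ aC).
rewrite scaler_sumr; apply: eq_bigr => i _.
rewrite -scalerAl -scalerAr scalerA -inv_fact_bin -1?ltnS //.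
rewrite -scaler_nat scalerA; congr (_ *: _).
have adX j u :
    iter i (commutator a) (u * a ^+ j) = iter i (commutator a) u * a ^+ j.
  have aaX : commutator a (a ^+ j) = 0 by rewrite /commutator -exprS exprSr subrr.
  by elim: (val i) => //= m ->; rewrite commutatorM aaX mulr0 addr0.
by rewrite rE adX.
Qed.

(** ((exp(ad a) - 1) / ad a)(D a): the left logarithmic derivative of exp(a).
    What matters is that only iterated commutators of a and D a occur. *)
Definition dlog (D : A -> A) a : A :=
  fsum F (fun m => (m.+1`!%:R : K)^-1 *: iter m (commutator a) (D a)).

Lemma der_fexp (D : {linear A -> A}) a :
  (forall x y, D (x * y) = D x * y + x * D y) ->
  (forall n x, F n.+1 x -> F n (D x)) -> F 1%N a ->
  D (fexp F a) = dlog D a * fexp F a.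
Proof.
move=> derM FD Fa; have Fe := divpow_graded Fa.
have Fad := ad_graded (D a) (fun m => (m.+1`!%:R)^-1) Fa.
rewrite /dlog [in RHS]/(fexp F a) -/(fsum F (divpow a)) (fsumM filtF) //.
have -> : fps_mul *%R (fun m => (m.+1`!%:R : K)^-1 *: iter m (commutator a) (D a))
    (divpow a) = fun n => D (divpow a n.+1).
  apply/funext => n; rewrite /divpow linearZ /= (derX derM) scaler_sumr.
  apply: eq_bigr => i _; rewrite -scalerAl -scalerAr scalerA.
  by rewrite -[in RHS]scaler_nat scalerA inv_fact_bin ?ltn_ord ?subSS.
apply: (fsum_unique filtF) => [n|N]; first exact/FD.
have D0 : D (divpow a 0) = 0 by rewrite /divpow linearZ /= der1 ?scaler0.
have -> : \sum_(n < N) D (divpow a n.+1) = D (\sum_(n < N.+1) divpow a n).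
  by rewrite raddf_sum [RHS]big_ord_recl /= D0 add0r.
rewrite -raddfB; exact/FD/fexp_mod.
Qed.

(** The logarithmic derivative of exp(a) exp(b) is built from a, b, D a and D b
    by commutators alone, so it can be transported along Lie morphisms that are
    not multiplicative. *)
Lemma der_fexpM (D : {linear A -> A}) a b :
  (forall x y, D (x * y) = D x * y + x * D y) ->
  (forall n x, F n.+1 x -> F n (D x)) -> F 1%N a -> F 1%N b ->
  D (fexp F a * fexp F b) =
  (dlog D a + expad a (dlog D b)) * (fexp F a * fexp F b).
Proof.
move=> derM FD Fa Fb; rewrite derM (der_fexp derM FD Fa) (der_fexp derM FD Fb).
by rewrite mulrDl !mulrA (fexp_conj _ Fa).
Qed.

(** Expresses exp(a) exp(b) through the iterates of u |-> a u + u b, the form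
    that left multiplication takes for the Grossman--Larson product. *)
Lemma fexpM a b : F 1%N a -> F 1%N b -> fexp F a * fexp F b =
  fsum F (fun n => (n`!%:R : K)^-1 *: iter n (fun u => a * u + u * b) 1).
Proof.
move=> Fa Fb; rewrite [fexp F a]/(fsum F (divpow a)).
rewrite [fexp F b]/(fsum F (divpow b)).
rewrite (fsumM filtF) //; [|exact: divpow_graded|exact: divpow_graded].
congr (fsum F _); apply/funext => n.
have abC u : (a \*o idfun) ((b \o* idfun) u) = (b \o* idfun) ((a \*o idfun) u).
  by rewrite /= mulrA.
rewrite (@iter_binomial _ (a \*o idfun) (b \o* idfun) _ _ abC) scaler_sumr.
have aE j u : iter j (a \*o idfun) u = a ^+ j * u.
  by elim: j => [|j /= ->]; rewrite ?mul1r // exprS mulrA.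
have bE j u : iter j (b \o* idfun) u = u * b ^+ j.
  by elim: j => [|j /= ->]; rewrite ?mulr1 // exprSr mulrA.
apply: eq_bigr => i _; rewrite -scalerAl -scalerAr scalerA -inv_fact_bin -1?ltnS //.
by rewrite aE bE mul1r -scaler_nat scalerA.
Qed.

Lemma fexpM_mod a b N : F 1%N a -> F 1%N b ->
  F N (fexp F a * fexp F b -
       \sum_(n < N) (n`!%:R : K)^-1 *: iter n (fun u => a * u + u * b) 1).
Proof.
move=> Fa Fb; rewrite fexpM //; apply: (fsum_mod filtF) => n.
apply: (filtZ filtF); elim: n => [|n IH]; first by rewrite (filt0 filtF).
rewrite iterS; apply: (filtD filtF).
  by rewrite -add1n; apply: (filtM filtF).
by rewrite -addn1; apply: (filtM filtF).
Qed.

Lemma fexpN a : F 1%N a -> fexp F a * fexp F (- a) = 1.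
Proof.
move=> Fa; rewrite fexpM //; last exact: (filtN filtF).
have iter0 n : iter n.+1 (fun u => a * u + u * - a) 1 = 0.
  rewrite iterSr mulr1 mul1r subrr.
  by elim: n => //= n ->; rewrite mulr0 mul0r addr0.
rewrite fsum_head => [|[|n]|n]; rewrite ?iter0 ?scaler0 //.
- by rewrite fact0 invr1 scale1r.
- by rewrite (filt0 filtF).
exact: (filt_zero filtF).
Qed.

Lemma fexpNl a : F 1%N a -> fexp F (- a) * fexp F a = 1.
Proof. by move=> Fa; rewrite -{2}[a]opprK fexpN //; apply: (filtN filtF). Qed.

(** The exponential is tangent to the identity: in x^(k+2) - y^(k+2) each term of
    the telescoping expansion has, next to the factor x - y in F (n+1), another
    factor in F 1. *)
Lemma fexp_tangent n x y : F 1%N x -> F 1%N y -> F n.+1 (x - y) ->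
  F n.+2 (fexp F x - fexp F y - (x - y)).
Proof.
move=> Fx Fy Fxy.
have FX k : F n.+2 (x ^+ k.+2 - y ^+ k.+2).
  rewrite [x ^+ _]exprS [y ^+ _]exprS.
  rewrite -[_ - _](subrKA (x * y ^+ k.+1)) -mulrBr -mulrBl -[n.+2]add1n.
  apply: (filtD filtF).
    by apply: (filtM filtF) => //; apply: (filt_eqX filtF).
  rewrite add1n -addn1; apply: (filtM filtF) => //.
  by rewrite exprSr; apply: (filtMl filtF).
have trunc z : \sum_(i < n.+2) divpow z i = 1 + (z + \sum_(i < n) divpow z i.+2).
  by rewrite !big_ord_recl /divpow /= fact0 invr1 !scale1r.
pose S z := \sum_(i < n.+2) divpow z i.
apply: (filt_trans filtF (y := S x - S y)).
  by apply: (filt_eqB filtF); apply: fexp_mod.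
rewrite /S !trunc opprD addrACA subrr add0r opprD addrACA.
rewrite [_ - _ + _]addrC addrK -sumrB.
by apply: (filt_sum filtF) => i _; rewrite -scalerBr; apply: (filtZ filtF).
Qed.

Lemma fexp_near n x y : F 1%N x -> F 1%N y -> F n (x - y) ->
  F n (fexp F x - fexp F y).
Proof.
case: n => [|n] Fx Fy Fxy; first by rewrite (filt0 filtF).
rewrite -[X in F _ X](subrK (x - y)); apply: (filtD filtF) => //.
exact/(filtS filtF)/fexp_tangent.
Qed.

(** * Atkinson factorization *)

(** The map z |-> exp(z + R z) exp(- R z), whose inversion is Atkinson's
    factorization; the equation atkinson z = exp x is what the Magnus expansion
    and the BCH-recursion have in common. *)
Definition atkinson z : A := fexp F (z + R z) * fexp F (- R z).

Lemma filt_RD n z : F n z -> F n (z + R z).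
Proof. by move=> Fz; apply/(filtD filtF)/(filt_rb filtF). Qed.

Lemma filt_RN n z : F n z -> F n (- R z).
Proof. by move=> Fz; apply/(filtN filtF)/(filt_rb filtF). Qed.

(** (z + R z) + (- R z) = z, so this map is tangent to the identity as well.
    Injectivity and, by successive approximation, surjectivity follow. *)
Lemma atkinson_tangent n x y : F 1%N x -> F 1%N y -> F n.+1 (x - y) ->
  F n.+2 (atkinson x - atkinson y - (x - y)).
Proof.
move=> Fx Fy Fxy; rewrite /atkinson.
have Fa : F n.+1 (x + R x - (y + R y)).
  by rewrite opprD addrACA -linearB; apply: filt_RD.
have Fb : F n.+1 (- R x - - R y) by rewrite -opprD -linearB; apply: filt_RN.
have xyE : x - y = x + R x - (y + R y) + (- R x - - R y).
  by rewrite opprK opprD addrACA addrK subrK.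
have [Fax Fay] := (filt_RD Fx, filt_RD Fy).
have [Fbx Fby] := (filt_RN Fx, filt_RN Fy).
move: xyE Fa Fb Fax Fay Fbx Fby; set a := x + R x; set b := - R x.
set a' := y + R y; set b' := - R y => -> Fa Fb Fax Fay Fbx Fby.
rewrite -[X in F _ (X - _)](subrKA (fexp F a' * fexp F b)) -mulrBl -mulrBr.
apply: (filt_eqD filtF).
  apply: (filt_trans filtF (y := fexp F a - fexp F a')); last exact: fexp_tangent.
  rewrite -{2}[fexp F a - _]mulr1 -mulrBr -addn1; apply: (filtM filtF).
    exact: fexp_near.
  exact: fexp_filt1.
apply: (filt_trans filtF (y := fexp F b - fexp F b')); last exact: fexp_tangent.
rewrite -{2}[fexp F b - _]mul1r -mulrBl -add1n; apply: (filtM filtF).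
  exact: fexp_filt1.
exact: fexp_near.
Qed.

Lemma atkinson_near n x y : F 1%N x -> F 1%N y -> F n (x - y) ->
  F n (atkinson x - atkinson y).
Proof.
case: n => [|n] Fx Fy Fxy; first by rewrite (filt0 filtF).
rewrite -[X in F _ X](subrK (x - y)); apply: (filtD filtF) => //.
exact/(filtS filtF)/atkinson_tangent.
Qed.

Lemma atkinson_inj x y : F 1%N x -> F 1%N y -> atkinson x = atkinson y -> x = y.
Proof.
move=> Fx Fy xy; suff Fxy n : F n.+1 (x - y).
  by apply: (filt_eq filtF) => n; apply/(filtS filtF).
elim: n => [|n /(atkinson_tangent Fx Fy)]; first exact: (filtB filtF).
by rewrite xy subrr sub0r => /(filtN filtF); rewrite opprK.
Qed.

(** The fixed point of z |-> z + (w - atkinson z), a contraction by tangency, as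
    the sum of the increments of its iterates from 0. *)
Lemma atkinson_surj w : F 1%N (w - 1) -> exists2 z, F 1%N z & atkinson z = w.
Proof.
move=> Fw; pose T z := z + (w - atkinson z).
have atk0 : atkinson 0 = 1.
  by rewrite /atkinson linear0 addr0 fexpN //; apply: (filt_zero filtF).
have atk1 z : F 1%N z -> F 1%N (atkinson z - 1).
  move=> Fz; rewrite -[1]mulr1; apply: (filt_eqM filtF); apply: fexp_filt1.
    exact: filt_RD.
  exact: filt_RN.
have FT z : F 1%N z -> F 1%N (T z).
  move=> Fz; apply: (filtD filtF) => //.
  by apply: (filt_trans filtF Fw); apply/(filtC filtF)/atk1.
pose z n := iter n T 0.
have Fz n : F 1%N (z n) by elim: n => [|n IH]; [apply: (filt_zero filtF)|apply: FT].
have zS n : z n.+1 - z n = w - atkinson (z n) by rewrite /z /= {1}/T addrC addKr.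
have dz n : F n.+1 (z n.+1 - z n).
  elim: n => [|n IH]; first by rewrite zS atk0.
  have := atkinson_tangent (Fz _) (Fz _) IH.
  by rewrite zS opprB subrKA zS => /(filtC filtF).
pose l := fsum F (fun n => z n.+1 - z n).
have Fdz : graded F (fun n => z n.+1 - z n) by move=> n; apply: (filtS filtF).
have lz n : F n (l - z n).
  have := fsum_mod filtF n Fdz.
  by rewrite -(big_mkord xpredT (fun n => z n.+1 - z n)) telescope_sumr // subr0.
have Fl : F 1%N l.
  by apply: (fsum_filt filtF) => // i; apply: (filt_le filtF) (dz i).
exists l => //; apply: (filt_eq filtF) => n.
apply: (filt_trans filtF (atkinson_near Fl (Fz n) (lz n))).
by apply: (filtC filtF); rewrite -zS.
Qed.

End Exponential.

(** * Power series: filtration and differential equations *)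

Definition fps_map (U V : Type) (f : U -> V) (a : fps U) : fps V := f \o a.

Lemma fps_mapE (U V : Type) (f : U -> V) a n : fps_map f a n = f (a n).
Proof. by []. Qed.

(** The t-adic filtration: multiples of t^n. *)
Definition fps_filt (K : fieldType) (U : algType K) (n : nat) : set (fps U) :=
  [set a | forall i, (i < n)%N -> a i = 0].
Arguments fps_filt {K U} n.

Section FpsMap.
Variables (K : fieldType) (U V : algType K).

Section Linear.
Variable f : {linear U -> V}.

Lemma fps_map_linear : linear (fps_map f).
Proof. by move=> k a b; apply/funext => n; rewrite /fps_map /= linearP. Qed.
HB.instance Definition _ :=
  GRing.isLinear.Build K (fps U) (fps V) *:%R (fps_map f) fps_map_linear.

Lemma fps_map_filt n a : fps_filt n a -> fps_filt n (fps_map f a).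
Proof. by move=> an i /an ai; rewrite /fps_map /= ai linear0. Qed.

(** The Cauchy product pairs a_i only with b_(n-i), so a map of coefficients that
    preserves commutators preserves those of series. *)
Lemma fps_map_commutator (a b : fps U) :
  (forall x y, f (commutator x y) = commutator (f x) (f y)) ->
  fps_map f (commutator a b) = commutator (fps_map f a) (fps_map f b).
Proof.
move=> fC; have swap (W : algType K) (x y : fps W) n :
    commutator x y n = \sum_(i < n.+1) commutator (x i) (y (n - i)%N).
  rewrite sumrB; congr (_ - _); rewrite fpsME (reindex_inj rev_ord_inj) /=.
  by apply: eq_bigr => i _; rewrite subSS subKn -1?ltnS.
apply/funext => n; rewrite fps_mapE !swap raddf_sum.
by apply: eq_bigr => i _ /=; rewrite fC.
Qed.
End Linear.

Lemma fps_mapM (g : {lrmorphism U -> V}) a b :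
  fps_map g (a * b) = fps_map g a * fps_map g b.
Proof.
apply/funext => n; rewrite fps_mapE !fpsME raddf_sum.
by apply: eq_bigr => i _ /=; rewrite rmorphM.
Qed.

Lemma fps_mapX (g : {lrmorphism U -> V}) a n :
  fps_map g (a ^+ n) = fps_map g a ^+ n.
Proof.
elim: n => [|n IH]; last by rewrite !exprS fps_mapM IH.
by apply/funext => -[|n]; rewrite /fps_map /= (rmorph1, rmorph0).
Qed.

End FpsMap.

Section FpsFiltration.
Variables (K : fieldType) (U : algType K).
Implicit Types (a b f g u : fps U).

(** Makes the theory of exponentials and of atkinson, developed for complete
    filtered algebras, available for power series, R acting on coefficients. *)
Lemma fps_filtration (R : {linear U -> U}) :
  complete_filtration (fps_map R) (@fps_filt K U).
Proof.
split=> //.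
- by apply/seteqP; split.
- by move=> n a an i /ltnW; apply: an.
- by move=> n k a b an bn i lt_in; rewrite fpsDE fpsZE an // bn // scaler0 addr0.
- move=> n a x xn; split=> i lt_in; rewrite fpsME big1 // => j _.
    by rewrite [x _]xn ?mulr0 // (leq_ltn_trans (leq_subr _ _)).
  by rewrite xn ?mul0r // (leq_trans _ lt_in).
- by move=> n a; apply: fps_map_filt.
- move=> m n a b am bn i lt_i; rewrite fpsME big1 // => j _.
  have [/am ->|le_mj] := ltnP j m; first by rewrite mul0r.
  rewrite [b _]bn ?mulr0 // ltn_subLR -1?ltnS //.
  by apply: leq_trans lt_i _; rewrite leq_add2r.
- by move=> a a0; apply/funext => n; apply: (a0 n.+1).
move=> u uC; have [M Mu] := choice uC.
exists (fun i => u (M i.+1) i) => N.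
pose m := \max_(i < N.+1) M i; exists m => n le_mn i lt_iN.
have le_M j : (j < N.+1)%N -> (M j <= n)%N.
  by move=> lt_j; apply: leq_trans le_mn; apply: (leq_bigmax (Ordinal lt_j)).
by apply: (Mu i.+1) => //; apply: le_M.
Qed.

Let filtU := fps_filtration (idfun : {linear U -> U}).

Lemma fps_filt1 a : a 0%N = 0 -> fps_filt 1 a.
Proof. by move=> a0 [|]. Qed.

Lemma fps_fexpE a n N : a 0%N = 0 -> (n < N)%N ->
  fexp fps_filt a n = \sum_(k < N) (k`!%:R : K)^-1 *: (a ^+ k) n.
Proof.
move=> /fps_filt1/(fexp_mod filtU N) aN ltnN.
by move: (aN n ltnN) => /eqP; rewrite fpsBE fps_sumE subr_eq0 => /eqP.
Qed.

Lemma fps_expE a : a 0%N = 0 -> fps_exp *%R 1 a = fexp fps_filt a.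
Proof.
move=> a0; apply/funext => n; rewrite (fps_fexpE (N := n.+1)) //.
by apply: eq_bigr => k _; rewrite fps_powE.
Qed.

Lemma fps_fexp0 a : a 0%N = 0 -> fexp fps_filt a 0%N = 1.
Proof.
move=> a0; rewrite (fps_fexpE (N := 1)) // big_ord1.
by rewrite fact0 invr1 scale1r.
Qed.

Lemma fps_comm a b : (forall i j, a i * b j = b j * a i) -> a * b = b * a.
Proof.
move=> ab; apply/funext => n; rewrite !fpsME (reindex_inj rev_ord_inj) /=.
by apply: eq_bigr => i _; rewrite subSS subKn -1?ltnS // ab.
Qed.

Definition fps_deriv a : fps U := fun n => a n.+1 *+ n.+1.

Lemma fps_deriv_linear : linear fps_deriv.
Proof.
move=> k a b; apply/funext => n.
by rewrite fpsDE fpsZE /fps_deriv fpsDE fpsZE mulrnDl scalerMnr.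
Qed.
HB.instance Definition _ :=
  GRing.isLinear.Build K (fps U) (fps U) *:%R fps_deriv fps_deriv_linear.

Lemma fps_derivM a b : fps_deriv (a * b) = fps_deriv a * b + a * fps_deriv b.
Proof.
apply/funext => n; rewrite fpsDE /fps_deriv !fpsME -sumrMnl.
pose c i := a i * b (n.+1 - i)%N.
transitivity (\sum_(i < n.+2) c i *+ i + \sum_(i < n.+2) c i *+ (n.+1 - i)).
  rewrite -big_split /=; apply: eq_bigr => i _.
  by rewrite -mulrnDr subnKC // -ltnS.
rewrite big_ord_recl mulr0n add0r [X in _ + X]big_ord_recr /= subnn mulr0n addr0.
congr (_ + _); apply: eq_bigr => i _; rewrite /c.
  by rewrite mulrnAl.
by rewrite -mulrnAr /= subSn // -ltnS.
Qed.

Lemma fps_deriv_filt n a : fps_filt n.+1 a -> fps_filt n (fps_deriv a).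
Proof. by move=> an i lt_in; rewrite /fps_deriv an // mul0rn. Qed.

Hypothesis charK : [pchar K] =i pred0.

(** In characteristic zero the equation f' = u f determines each coefficient
    of f from the previous ones. *)
Lemma fps_ode_unique u f g :
  fps_deriv f = u * f -> fps_deriv g = u * g -> f 0%N = g 0%N -> f = g.
Proof.
move=> fE gE fg0; apply/eqP; rewrite -subr_eq0; apply/eqP.
have hE : fps_deriv (f - g) = u * (f - g) by rewrite linearB /= fE gE mulrBr.
have h0 : (f - g) 0%N = 0 by rewrite fpsBE fg0 subrr.
move: (f - g) hE h0 => h hE h0; apply/funext => n.
elim/ltn_ind: n => -[|n] IH //; apply/eqP.
have /eqP : h n.+1 *+ n.+1 = 0.
  transitivity ((u * h) n); first by rewrite -hE.
  by rewrite fpsME big1 // => i _; rewrite IH ?mulr0 // ltnS leq_subr.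
by rewrite -scaler_nat scaler_eq0 (negPf (natS_neq0 charK n)).
Qed.

Lemma deriv_fexp a : a 0%N = 0 ->
  fps_deriv (fexp fps_filt a) = dlog fps_filt fps_deriv a * fexp fps_filt a.
Proof.
move=> /fps_filt1 a0; apply: (der_fexp charK filtU) => //; first exact: fps_derivM.
exact: fps_deriv_filt.
Qed.

(** When a commutes with its derivative only the term without commutators
    remains, and (exp a)' = a' exp a as in the commutative case. *)
Lemma dlog_comm a : a 0%N = 0 -> a * fps_deriv a = fps_deriv a * a ->
  dlog fps_filt fps_deriv a = fps_deriv a.
Proof.
move=> /fps_filt1 a0 aC.
have ad0 m : iter m.+1 (commutator a) (fps_deriv a) = 0.
  by rewrite iterSr {2}/commutator aC subrr; elim: m => //= m ->; rewrite linear0.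
rewrite /dlog (fsum_head filtU) => [|n|n]; last by rewrite ad0 scaler0.
  by rewrite invr1 scale1r.
case: n => [|n]; first by rewrite (filt0 filtU).
by rewrite ad0 scaler0; apply: (filt_zero filtU).
Qed.

Lemma deriv_fexpM a b : a 0%N = 0 -> b 0%N = 0 ->
  fps_deriv (fexp fps_filt a * fexp fps_filt b) =
  (dlog fps_filt fps_deriv a + expad fps_filt a (dlog fps_filt fps_deriv b)) *
  (fexp fps_filt a * fexp fps_filt b).
Proof.
move=> /fps_filt1 a0 /fps_filt1 b0.
apply: (der_fexpM charK filtU _ _ a0 b0); first exact: fps_derivM.
exact: fps_deriv_filt.
Qed.

Definition fps_const (x : U) : fps U := fun n => if n == 0%N then x else 0.
Definition fps_lin (x : U) : fps U := fun n => if n == 1%N then x else 0.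

Lemma deriv_fexp_lin x : fps_deriv (fexp fps_filt (fps_lin x)) =
  fps_const x * fexp fps_filt (fps_lin x).
Proof.
have dE : fps_deriv (fps_lin x) = fps_const x.
  by apply/funext => -[|n]; rewrite /fps_deriv //= mul0rn.
rewrite deriv_fexp // dlog_comm // dE //; apply: fps_comm => i j.
by rewrite /fps_lin /fps_const; do 2![case: eqP => _]; rewrite ?mulr0 ?mul0r.
Qed.

End FpsFiltration.
Arguments fps_deriv {K U} a n.

Section FpsMapExp.
Variables (K : fieldType) (U V : algType K).
Let filtU := fps_filtration (idfun : {linear U -> U}).
Implicit Types a v : fps U.
Let filtV := fps_filtration (idfun : {linear V -> V}).

Lemma fps_map_fexp (g : {lrmorphism U -> V}) a : a 0%N = 0 ->
  fps_map g (fexp fps_filt a) = fexp fps_filt (fps_map g a).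
Proof.
move=> a0; apply/funext => n; rewrite fps_mapE !(fps_fexpE (N := n.+1)) //.
  rewrite raddf_sum; apply: eq_bigr => k _ /=.
  by rewrite linearZ /= -fps_mapX.
by rewrite fps_mapE a0 rmorph0.
Qed.

Variable f : {linear U -> V}.
Hypothesis fC : forall x y, f (commutator x y) = commutator (f x) (f y).

Lemma fps_map_deriv a : fps_map f (fps_deriv a) = fps_deriv (fps_map f a).
Proof. by apply/funext => n; rewrite fps_mapE raddfMn. Qed.

Lemma fps_map_ad m a v : fps_map f (iter m (commutator a) v) =
  iter m (commutator (fps_map f a)) (fps_map f v).
Proof. by elim: m => //= m <-; rewrite fps_map_commutator. Qed.

Lemma fps_map_fsum (p : nat -> fps U) : graded fps_filt p ->
  fps_map f (fsum fps_filt p) = fsum fps_filt (fun n => fps_map f (p n)).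
Proof.
by move=> Fp; rewrite (fsum_map filtU filtV) // => n x; apply: fps_map_filt.
Qed.

Lemma fps_map_expad a v : a 0%N = 0 ->
  fps_map f (expad fps_filt a v) = expad fps_filt (fps_map f a) (fps_map f v).
Proof.
move=> /fps_filt1 a0; rewrite /expad fps_map_fsum; last exact: (ad_graded filtU).
by congr (fsum _ _); apply/funext => n; rewrite linearZ /= fps_map_ad.
Qed.

Lemma fps_map_dlog a : a 0%N = 0 ->
  fps_map f (dlog fps_filt fps_deriv a) = dlog fps_filt fps_deriv (fps_map f a).
Proof.
move=> /fps_filt1 a0; rewrite /dlog fps_map_fsum; last exact: (ad_graded filtU).
congr (fsum _ _); apply/funext => n.
by rewrite linearZ /= fps_map_ad fps_map_deriv.
Qed.

End FpsMapExp.

(** * Evaluation of power series at t = 1 *)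

Section Evaluation.
Variables (K : fieldType) (A : algType K) (R : {linear A -> A}).
Hypothesis charK : [pchar K] =i pred0.
Variables (F : nat -> set A) (filtF : complete_filtration R F).
Implicit Types (a b : fps A) (w : A).

Lemma gradedX a k : graded F a -> graded F (a ^+ k).
Proof.
move=> Fa; elim: k => [|k IH]; last by rewrite exprS; apply: (gradedM filtF).
by case=> [|n]; [rewrite (filt0 filtF) | apply: (filt_zero filtF)].
Qed.

Lemma graded_fexp a : a 0%N = 0 -> graded F a -> graded F (fexp fps_filt a).
Proof.
move=> a0 Fa n; rewrite (fps_fexpE a0 (ltnSn n)).
by apply: (filt_sum filtF) => k _; apply/(filtZ filtF)/gradedX.
Qed.

Lemma fsumX a k : graded F a -> fsum F (a ^+ k) = fsum F a ^+ k.
Proof.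
move=> Fa; elim: k => [|k IH].
  by rewrite (fsum_head filtF) //; apply: (gradedX 0 Fa).
by rewrite !exprS -IH (fsumM filtF) //; apply: gradedX.
Qed.

Lemma fsum_filt1 a : a 0%N = 0 -> graded F a -> F 1%N (fsum F a).
Proof.
move=> a0 Fa; apply: (fsum_filt filtF) => // -[|n]; last first.
  exact: (filt_le filtF) (Fa _).
by rewrite a0; apply: (filt_zero filtF).
Qed.

(** Evaluation at t = 1 commutes with exp: both sides agree modulo F N with the
    double sum over k, n < N of the n-th coefficients of a^k / k!. *)
Lemma fsum_fexp a : a 0%N = 0 -> graded F a ->
  fsum F (fexp fps_filt a) = fexp F (fsum F a).
Proof.
move=> a0 Fa; apply: (filt_eq filtF) => N.
apply: (filt_trans filtF (fsum_mod filtF N (graded_fexp a0 Fa))).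
under eq_bigr => n _ do rewrite (fps_fexpE a0 (ltn_ord n)).
rewrite exchange_big /=.
apply: (filt_trans filtF (y := \sum_(k < N) divpow (fsum F a) k)); last first.
  exact/(filtC filtF)/(fexp_mod filtF)/fsum_filt1.
rewrite -sumrB; apply: (filt_sum filtF) => k _.
rewrite /divpow -fsumX // -scaler_sumr -scalerBr; apply/(filtZ filtF)/(filtC filtF).
exact/(fsum_mod filtF)/gradedX.
Qed.

Lemma fsum_shift (p : nat -> A) : (forall n, F n.+1 (p n)) ->
  fsum F (fun n => if n is m.+1 then p m else 0) = fsum F p.
Proof.
move=> Fp; have Fp' : graded F p by move=> n; apply: (filtS filtF).
apply/esym/(fsum_unique filtF) => -[|n] //; try exact: (filt_zero filtF).
  by rewrite (filt0 filtF).
rewrite big_ord_recl add0r /=.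
have := fsum_mod filtF n.+1 Fp'; rewrite big_ord_recr /= opprD addrA => Fn.
by rewrite -[X in F _ X](subrK (p n)); apply: (filtD filtF).
Qed.

(** log(1 + w t). *)
Definition log_series w : fps A :=
  fun n => if n is m.+1 then ((-1) ^+ m / m.+1%:R : K) *: w ^+ m.+1 else 0.

Lemma deriv_log_series w n : fps_deriv (log_series w) n = (-1) ^+ n *: w ^+ n.+1.
Proof.
rewrite /fps_deriv /= -scaler_nat scalerA mulrC mulfVK //.
exact: natS_neq0.
Qed.

(** exp(log(1 + w t)) = 1 + w t, because both sides start with 1 and satisfy
    f' = u f for u = (log(1 + w t))' = w / (1 + w t). *)
Lemma fexp_log_series w : fexp fps_filt (log_series w) =
  fun n => if n is m.+1 then (if m is 0 then w else 0) else 1.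
Proof.
set g : fps A := (fun n : nat => _).
have L0 : log_series w 0%N = 0 by [].
apply: (fps_ode_unique charK (u := fps_deriv (log_series w))).
- rewrite deriv_fexp // dlog_comm //; apply: fps_comm => -[|i] j.
    by rewrite mul0r mulr0.
  rewrite deriv_log_series -!scalerAl -!scalerAr !scalerA mulrC.
  by rewrite -!exprD addnC.
- apply/funext => -[|n]; rewrite fpsME.
    by rewrite big_ord1 deriv_log_series /fps_deriv /= mulr1 scale1r.
  rewrite !big_ord_recr /= !deriv_log_series subnn mulr1.
  rewrite subSnn /= -scalerAl -exprSr [in X in _ + X]exprS mulN1r scaleNr addrK.
  rewrite big1 => [|i _]; last first.
    have gE m : (0 < m)%N -> g m.+1 = 0 by case: m.
    by rewrite subSn 1?ltnW // gE ?mulr0 // subn_gt0.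
  by rewrite /fps_deriv mul0rn.
by rewrite fps_fexp0.
Qed.

(** The previous identity at t = 1. *)
Lemma flogK w : F 1%N (w - 1) -> F 1%N (flog F w) /\ fexp F (flog F w) = w.
Proof.
move=> Fw; have FX n : F n.+1 (((-1) ^+ n / n.+1%:R : K) *: (w - 1) ^+ n.+1).
  exact/(filtZ filtF)/(filtX filtF).
have FL : graded F (log_series (w - 1)).
  by case=> [|n]; [rewrite (filt0 filtF) | apply: FX].
have logE : flog F w = fsum F (log_series (w - 1)) by rewrite fsum_shift.
rewrite logE; split; first exact: fsum_filt1.
rewrite -fsum_fexp //; have := graded_fexp (erefl _) FL.
rewrite fexp_log_series => Fg; rewrite -[RHS](subrK 1) [RHS]addrC.
apply/esym/(fsum_unique filtF) => // -[|[|n]].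
- by rewrite (filt0 filtF).
- by rewrite big_ord1 addrAC subrr add0r.
rewrite 2!big_ord_recl /= big1 // addr0 subrr; exact: (filt_zero filtF).
Qed.

Section AtkinsonSeries.
Variable c : fps A.
Hypothesis c0 : c 0%N = 0.

Lemma atkinson_left0 : (c + fps_map R c) 0%N = 0.
Proof. by rewrite fpsDE fps_mapE c0 linear0 addr0. Qed.

Lemma atkinson_right0 : (- fps_map R c) 0%N = 0.
Proof. by rewrite fpsNE fps_mapE c0 linear0 oppr0. Qed.

Hypothesis Fc : graded F c.

Let FR : graded F (fps_map R c).
Proof. by move=> n; apply: (filt_rb filtF). Qed.

Let Fl : graded F (c + fps_map R c).
Proof. by move=> n; apply: (filtD filtF). Qed.

Let Fr : graded F (- fps_map R c).
Proof. by move=> n; apply: (filtN filtF). Qed.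

Lemma atkinson_eval :
  fsum F (atkinson (fps_map R) fps_filt c) = atkinson R F (fsum F c).
Proof.
have RE : fsum F (fps_map R c) = R (fsum F c).
  by rewrite (fsum_map filtF filtF) // => n x; apply: (filt_rb filtF).
have lE : fsum F (c + fps_map R c) = fsum F c + R (fsum F c).
  by rewrite -RE; exact: (fsumD filtF).
have rE : fsum F (- fps_map R c) = - R (fsum F c).
  rewrite -RE (fsum_map filtF filtF (h := -%R)) // => n x; exact: (filtN filtF).
rewrite /atkinson -lE -rE.
rewrite -(fsum_fexp atkinson_left0 Fl) -(fsum_fexp atkinson_right0 Fr).
by rewrite (fsumM filtF) //; apply: graded_fexp;
  rewrite ?atkinson_left0 ?atkinson_right0.
Qed.

Lemma atkinson_graded : graded F (atkinson (fps_map R) fps_filt c).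
Proof.
by apply: (gradedM filtF); apply: graded_fexp;
  rewrite ?atkinson_left0 ?atkinson_right0.
Qed.

End AtkinsonSeries.

(** By tangency, the coefficient of t^n in atkinson c is c_n plus an expression in
    the lower coefficients; if those are graded, so is that expression. *)
Lemma graded_of_atkinson (c : fps A) : c 0%N = 0 ->
  graded F (atkinson (fps_map R) fps_filt c) -> graded F c.
Proof.
move=> c0 Fatk; elim/ltn_ind => -[|n] IH; first by rewrite (filt0 filtF).
(* The truncation of c below degree n.+1 agrees with c up to that degree. *)
pose c' : fps A := fun i => if (i < n.+1)%N then c i else 0.
have Fc' : graded F c'.
  by move=> i; rewrite /c'; case: ltnP => [/IH//|_]; apply: (filt_zero filtF).
have cc' : fps_filt n.+1 (c - c') by move=> i lt_in; rewrite fpsBE /c' lt_in subrr.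
have := atkinson_tangent (fps_filtration R) (fps_filt1 c0)
  (fps_filt1 (c0 : c' 0%N = 0)) cc' n.+1 (ltnSn n.+1).
rewrite !fpsBE {2}/c' ltnn subr0 => /eqP; rewrite subr_eq0 => /eqP <-.
exact: (filtB filtF (Fatk n.+1) (atkinson_graded (c0 : c' 0%N = 0) Fc' n.+1)).
Qed.

End Evaluation.

(** * The enveloping algebra and the Grossman--Larson product *)

Section EnvelopeInduction.
Variables (K : fieldType) (L : lmodType K) (P : postlie L) (E : envelope P).
Variable S : env E -> Prop.
Hypothesis S_in : forall x, S (env_in E x).
Hypothesis S1 : S 1.
Hypothesis S_linear : forall (k : K) X Y, S X -> S Y -> S (k *: X + Y).
Hypothesis SM : forall X Y, S X -> S Y -> S (X * Y).

Let Sb : {pred env E} := fun X => `[<S X>].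

Let Sb_subalg : GRing.subalg_closed Sb.
Proof.
split; rewrite /Sb ?unfold_in /=.
- exact/asboolP.
- by move=> k X Y /asboolP SX /asboolP SY; apply/asboolP; apply: S_linear.
- by move=> X Y /asboolP SX /asboolP SY; apply/asboolP; apply: SM.
Qed.

HB.instance Definition _ :=
  GRing.isSubalgClosed.Build K (env E) Sb (GRing.subalg_closed_semi Sb_subalg).

Let subenv : Type := {X : env E | Sb X}.
HB.instance Definition _ := SubType.on subenv.
HB.instance Definition _ := Choice.on subenv.
HB.instance Definition _ := [SubChoice_isSubAlgebra of subenv by <:].

Let subval : subenv -> env E := val.
HB.instance Definition _ :=
  GRing.RMorphism.copy subval (val : {rmorphism subenv -> env E}).
HB.instance Definition _ :=
  GRing.isScalable.Build K subenv (env E) *:%R subval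
    (linearZ_LR (val : {linear subenv -> env E})).

Let subenv_in (x : L) : subenv := exist _ (env_in E x) (asboolT (S_in x)).

Let subenv_in_linear : linear subenv_in.
Proof. by move=> k x y; apply: val_inj; rewrite /= linearP. Qed.

HB.instance Definition _ :=
  GRing.isLinear.Build K L subenv *:%R subenv_in subenv_in_linear.

(** The enveloping algebra is generated by the image of L. With the universal
    property as its only description, the proof is: S defines a subalgebra
    containing that image, the induced map into it composed with the inclusion is
    an endomorphism fixing that image, hence the identity. *)
Lemma env_ind X : S X.
Proof.
have [|g [g_in _]] := env_universal E (f := subenv_in : {linear L -> subenv}).
  by move=> x y; apply: val_inj; rewrite /= env_in_lie.
have [g0 [_ g0_unique]] := env_universal E (env_in_lie E).
have idE : X = g0 X by apply: (g0_unique idfun).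
have valE : val (g X) = g0 X.
  by apply: (g0_unique (subval \o g)) => x /=; rewrite g_in.
by rewrite idE -valE; apply/asboolP/(valP (g X)).
Qed.

End EnvelopeInduction.

Section EnvelopeAction.
Variables (K : fieldType) (L : lmodType K) (P : postlie L).
Variable E : postlie_envelope P.
Implicit Types (x : L) (X Y Z : env E).

(** The sum on the left depends only on the coproduct, since f factors through
    the tensor square; on a generator the coproduct is explicit. *)
Lemma sweedler_in (V : lmodType K) (f : {bilinear env E -> env E -> V}) x :
  \sum_(p <- sweedler (env_in E x)) f p.1 p.2 = f (env_in E x) 1 + f 1 (env_in E x).
Proof.
have /= sE : coprod E (env_in E x) =
    \sum_(p <- sweedler (env_in E x)) tens E p.1 p.2.
  (* The definition of sweedler picks some list; this one shows that it exists. *)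
  pose s := [:: (env_in E x, 1 : env E); (1, env_in E x)].
  apply: (xgetPex (P := [set s : seq (env E * env E) |
    coprod E (env_in E x) = \sum_(p <- s) tens E p.1 p.2]) [::]).
  exists s => /=.
  by rewrite coprod_in /s !big_cons big_nil addr0.
have [g [gE _]] := tens_universal f.
under eq_bigr do rewrite -gE.
by rewrite -raddf_sum -sE coprod_in raddfD /= !gE.
Qed.

Section Bilinear.
Variables Y Z : env E.

(** The bilinear forms under the two Sweedler sums, to which the universal
    property of the tensor square is applied. *)
Definition star_form (X X' : env E) : env E := X * etri E X' Y.

Lemma star_form_bilinear : bilinear_for *:%R *:%R star_form.
Proof.
split=> X k X1 X2; rewrite /star_form; first by rewrite mulrDl -scalerAl.
by rewrite linearPl /= mulrDr -scalerAr.
Qed.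
HB.instance Definition _ := bilinear_isBilinear.Build K (env E) (env E) (env E)
  *:%R *:%R star_form star_form_bilinear.

Definition leibniz_form (X X' : env E) : env E := etri E X Y * etri E X' Z.

Lemma leibniz_form_bilinear : bilinear_for *:%R *:%R leibniz_form.
Proof.
split=> X k X1 X2; rewrite /leibniz_form linearPl /=.
  by rewrite mulrDl -scalerAl.
by rewrite mulrDr -scalerAr.
Qed.
HB.instance Definition _ := bilinear_isBilinear.Build K (env E) (env E) (env E)
  *:%R *:%R leibniz_form leibniz_form_bilinear.
End Bilinear.

Lemma etri_in1 x : etri E (env_in E x) 1 = 0.
Proof. by rewrite etri1r counit_in scale0r. Qed.

Lemma etri_inM x Y Z : etri E (env_in E x) (Y * Z) =
  etri E (env_in E x) Y * Z + Y * etri E (env_in E x) Z.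
Proof.
by rewrite etriMr (sweedler_in (leibniz_form Y Z)) /= /leibniz_form !etri1l.
Qed.

Lemma grossman_larson_in x Y : grossman_larson E (env_in E x) Y =
  env_in E x * Y + etri E (env_in E x) Y.
Proof.
by rewrite /grossman_larson (sweedler_in (star_form Y)) /= /star_form etri1l mul1r.
Qed.

End EnvelopeAction.

Section RotaBaxterEnvelope.
Variables (K : fieldType) (A : algType K) (R : {linear A -> A}).
Variables (rbR : rota_baxter 1 R) (E : postlie_envelope (rb_postlie rbR)).
Notation iota := (env_in E).

Lemma env_in_commutator x y :
  iota (commutator x y) = commutator (iota x) (iota y).
Proof. exact: (env_in_lie E x y). Qed.

(** Both sides are derivations in Y, and they agree on generators by the
    definition of the post-Lie product of a Rota--Baxter algebra. *)
Lemma etri_commutator x Y : etri E (iota x) Y = commutator (iota (R x)) Y.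
Proof.
elim/(@env_ind _ _ _ E): Y => [y||k Y Z IHY IHZ|Y Z IHY IHZ].
- by rewrite etri_in /= /rb_triangle env_in_commutator.
- by rewrite etri_in1 /commutator mulr1 mul1r subrr.
- by rewrite !linearPr /= IHY IHZ.
by rewrite etri_inM IHY IHZ commutatorM.
Qed.

(** The key to the theorem: left star-multiplication by an element of A is a left
    multiplication plus a right multiplication, and these commute. *)
Lemma rb_grossman_larson x Y :
  grossman_larson E (iota x) Y = iota (x + R x) * Y - Y * iota (R x).
Proof.
by rewrite grossman_larson_in etri_commutator linearD mulrDl addrA.
Qed.

(** The identity of A is a Lie morphism into the associative algebra A, so it
    extends to the enveloping algebra; in particular iota is injective. *)
Lemma env_retraction :
  exists g : {lrmorphism env E -> A}, forall x, g (iota x) = x.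
Proof.
by have [|g [gE _]] := env_universal E (f := idfun : {linear A -> A});
  last exists g.
Qed.

End RotaBaxterEnvelope.

(** * The Magnus expansion and the BCH-recursion *)

Section MagnusFactorization.
Variables (K : fieldType) (charK : [pchar K] =i pred0).
Variables (A : algType K) (R : {linear A -> A}) (rbR : rota_baxter 1 R).
Variable E : postlie_envelope (rb_postlie rbR).
Notation iota := (env_in E).
Implicit Types (x : A) (c : fps A).

Let filtA := fps_filtration R.
Let filtU := fps_filtration (idfun : {linear env E -> env E}).

Lemma star_series c (Y : fps (env E)) :
  fps_mul (grossman_larson E) (fps_map iota c) Y =
  fps_map iota (c + fps_map R c) * Y + Y * fps_map iota (- fps_map R c).
Proof.
apply/funext => n; rewrite fpsDE !fpsME [X in _ = _ + X](reindex_inj rev_ord_inj).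
rewrite -big_split; apply: eq_bigr => i _ /=; rewrite subSS subKn -1?ltnS //.
by rewrite rb_grossman_larson !fps_mapE fpsDE fpsNE linearN mulrN.
Qed.

(** exp^*(c) = exp(c + R c) exp(- R c): the iterates of the left multiplication of
    the previous lemma are those of the formula for a product of exponentials. *)
Lemma star_exp_factorization c : c 0%N = 0 ->
  fps_exp (grossman_larson E) 1 (fps_map iota c) =
  fexp fps_filt (fps_map iota (c + fps_map R c)) *
  fexp fps_filt (fps_map iota (- fps_map R c)).
Proof.
move=> c0; set a := fps_map iota (_ + _); set b := fps_map iota (- _).
have a0 : fps_filt 1 a.
  by apply: fps_filt1; rewrite /a fps_mapE (atkinson_left0 R c0) linear0.
have b0 : fps_filt 1 b.
  by apply: fps_filt1; rewrite /b fps_mapE (atkinson_right0 R c0) linear0.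
apply/funext => n.
have /eqP := fexpM_mod charK filtU n.+1 a0 b0 n (ltnSn n).
rewrite fpsBE fps_sumE subr_eq0 => /eqP ->.
apply: eq_bigr => k _; rewrite fpsZE; congr (_ *: _).
(* The unit sequence in the definition of fps_pow is the unit series. *)
suff -> : fps_pow (grossman_larson E) 1 (fps_map iota c) k =
    iter k (fun u => a * u + u * b) 1 by [].
by elim: (val k) => //= m <-; rewrite -star_series.
Qed.

(** Reading the factorization over A rather than over its enveloping algebra. From
    the latter to A one applies the retraction. The other way the inclusion
    preserves only commutators, which suffices: over A the logarithmic derivative
    of exp(c + R c) exp(- R c) is that of exp(tx), namely x; it is made of
    commutators, so the same holds over the enveloping algebra, and the equation
    f' = x f then determines the product of exponentials. *)
Lemma magnus_seriesP x c :
  magnus_series E x (fun n => iota (c n)) <->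
  c 0%N = 0 /\ atkinson (fps_map R) fps_filt c = fexp fps_filt (fps_lin x).
Proof.
have linE : (fun n : nat => if n == 1%N then iota x else 0) =
    fps_map iota (fps_lin x).
  by apply/funext => n; rewrite fps_mapE /fps_lin; case: ifP; rewrite ?linear0.
have [g gK] := env_retraction E.
have gKs a : fps_map g (fps_map iota a) = a.
  by apply/funext => n; rewrite !fps_mapE gK.
have iota0 (a : fps A) : a 0%N = 0 -> fps_map iota a 0%N = 0.
  by move=> a0; rewrite fps_mapE a0 linear0.
rewrite /magnus_series linE fps_expE ?iota0 //; split=> [[ic0]|[c0 cE]].
  have c0 : c 0%N = 0 by rewrite -[c 0%N]gK ic0 rmorph0.
  have l0 := atkinson_left0 R c0; have r0 := atkinson_right0 R c0.
  have gexp a : a 0%N = 0 ->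
      fps_map g (fexp fps_filt (fps_map iota a)) = fexp fps_filt a.
    by move=> a0; rewrite (fps_map_fexp g (iota0 a a0)) gKs.
  rewrite (star_exp_factorization c0) => /funext/(congr1 (fps_map g)) gE.
  split=> //; rewrite (gexp (fps_lin x) erefl) in gE; rewrite -gE.
  rewrite fps_mapM; exact: (esym (f_equal2 *%R (gexp _ l0) (gexp _ r0))).
have l0 := atkinson_left0 R c0; have r0 := atkinson_right0 R c0.
split=> [|n]; first by rewrite c0 linear0.
rewrite (star_exp_factorization c0); congr (_ n).
pose Phi := dlog fps_filt fps_deriv (c + fps_map R c) +
  expad fps_filt (c + fps_map R c) (dlog fps_filt fps_deriv (- fps_map R c)).
have PhiE : Phi = fps_const x.
  have : Phi * fexp fps_filt (fps_lin x) = fps_const x * fexp fps_filt (fps_lin x).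
    by rewrite -(deriv_fexp_lin charK) -cE /atkinson (deriv_fexpM charK l0 r0).
  move=> /(congr1 (fun u => u * fexp fps_filt (- fps_lin x))).
  have xN := fexpN charK filtA (fps_filt1 (erefl : fps_lin x 0%N = 0)).
  by rewrite -mulrA xN mulr1 -mulrA xN mulr1.
have iC := @env_in_commutator _ _ _ rbR E.
apply: (fps_ode_unique charK (u := fps_map iota (fps_const x))).
- rewrite (deriv_fexpM charK (iota0 _ l0) (iota0 _ r0)) -PhiE; congr (_ * _).
  apply/esym; rewrite /Phi raddfD /=.
  by rewrite (fps_map_dlog iC l0) (fps_map_expad iC _ l0) (fps_map_dlog iC r0).
- have -> : fps_map iota (fps_lin x) = fps_lin (iota x) by rewrite -linE.
  rewrite (deriv_fexp_lin charK); congr (_ * _); apply/funext => m.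
  by rewrite fps_mapE /fps_const; case: ifP; rewrite ?linear0.
rewrite fpsME big_ord1 (fps_fexp0 (iota0 _ l0)) (fps_fexp0 (iota0 _ r0)) mulr1.
by rewrite (fps_fexp0 (iota0 (fps_lin x) erefl)).
Qed.

End MagnusFactorization.

(** The recursion at weight 1 says BCH(R z, - z - R z) = - x, that is,
    exp(R z) exp(- z - R z) = exp(- x); now take inverses. *)
Lemma bch_recursion_atkinson (K : fieldType) (charK : [pchar K] =i pred0)
    (A : algType K) (R : {linear A -> A}) (F : nat -> set A)
    (filtF : complete_filtration R F) (chi1 : A -> A) (x : A) :
  bch_recursion F 1 R chi1 -> F 1%N x -> atkinson R F (chi1 x) = fexp F x.
Proof.
move=> /(_ x) rec Fx; have [Fz] := rec Fx; move: (chi1 x) Fz => z Fz.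
have FRz : F 1%N (R z) by apply: (filt_rb filtF).
have Fl := filt_RD filtF Fz.
have RtE : - (1 *: z) - R z = - (z + R z) by rewrite scale1r opprD.
rewrite RtE invr1 scale1r /BCHtilde => zE.
have {zE} : BCH F (R z) (- (z + R z)) = - x.
  move: (BCH _ _ _) zE => B; rewrite opprK -addrA [- R z + _]addrCA addNr addr0.
  rewrite addrA => /esym/(canRL (addrK z)); rewrite subrr addrC.
  by move=> /(canRL (addrK x)); rewrite sub0r.
rewrite /BCH => logE; have FN := filtN filtF Fl.
have Fw : F 1%N (fexp F (R z) * fexp F (- (z + R z)) - 1).
  by rewrite -[1]mulr1; apply: (filt_eqM filtF); apply: (fexp_filt1 filtF).
have [_] := flogK charK filtF Fw; rewrite logE => wE.
(* exp(-x) is the inverse of atkinson z. *)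
have -> : fexp F x = fexp F x * fexp F (- x) * (fexp F (z + R z) * fexp F (- R z)).
  rewrite wE -!mulrA [fexp F (- (z + R z)) * _]mulrA.
  by rewrite (fexpNl charK filtF Fl) mul1r (fexpN charK filtF FRz) mulr1.
by rewrite (fexpN charK filtF Fx) mul1r.
Qed.

Theorem theorem5p3 (K : fieldType) (charK : [pchar K] =i pred0)
    (A : algType K) (R : {linear A -> A}) (rbR : rota_baxter 1 R)
    (F : nat -> set A) (filtF : complete_filtration R F)
    (E : postlie_envelope (rb_postlie rbR))
    (chi1 : A -> A) (chi1_rec : bch_recursion F 1 R chi1) (x : A) :
  F 1%N x -> forall y : A, magnus_expansion F E x y <-> y = chi1 x.
Proof.
move=> Fx.
have Ft : graded F (fps_lin x : fps A).
  by case=> [|[|n]]; rewrite ?(filt0 filtF) //; apply: (filt_zero filtF).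
have [Fchi _] := chi1_rec x Fx.
have tE : fsum F (fps_lin x : fps A) = x.
  apply/esym/(fsum_unique filtF) => // -[|[|n]]; first by rewrite (filt0 filtF).
    by rewrite big_ord1 subr0.
  rewrite 2!big_ord_recl /= big1 // /fps_lin /= add0r addr0 subrr.
  exact: (filt_zero filtF).
have sumP (c : fps A) : magnus_series E x (fun n => env_in E (c n)) ->
    fcvg F (fun N => \sum_(n < N) c n) (chi1 x).
  move=> /(magnus_seriesP charK)[c0 cE].
  have Fe := graded_fexp filtF (erefl : fps_lin x 0%N = 0) Ft.
  have Fc : graded F c by apply: (graded_of_atkinson filtF c0); rewrite cE.
  suff -> : chi1 x = fsum F c by exact: (fsum_cvg filtF).
  apply: (atkinson_inj filtF Fchi (fsum_filt1 filtF c0 Fc)).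
  rewrite (bch_recursion_atkinson charK filtF chi1_rec Fx).
  rewrite -(atkinson_eval filtF c0 Fc) cE (fsum_fexp filtF erefl Ft).
  by rewrite tE.
move=> y; split=> [[c /sumP c_chi c_y]|->]; first exact: (fcvg_unique filtF c_y).
have F1t := fps_filt1 (erefl : fps_lin x 0%N = 0).
have [c c1 cE] := atkinson_surj charK (fps_filtration R)
  (fexp_filt1 (fps_filtration R) F1t).
have cM : magnus_series E x (fun n => env_in E (c n)).
  by apply/(magnus_seriesP charK); split=> //; apply: c1.
by exists c => //; apply: sumP.
Qed.
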